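(* Let $1/\sqrt5\le c<3/2$ and $y_n=c/n^2$. Then the closed set $\mathcal E_c\subset\mathcal M$ satisfies $\mu_{\mathcal M}(\mathcal E_c)<1$, and for every irrational $x\in[0,1)$, $\mathcal R_n(x,y_n)\subset\mathcal E_c$ for infinitely many $n\in\mathbb N$.
   Context: $\Gamma=\mathrm{SL}_2(\mathbb Z)$, $\mathcal M=\Gamma\backslash\mathbb H$, $\mu_{\mathcal M}=\frac3\pi\frac{dx\,dy}{y^2}$ the normalized hyperbolic area. For $c>0$, $\mathcal E_c$ is the image under $\mathbb H\to\mathcal M$ of $\{z\in\mathbb H:\mathrm{Im}(z)\in[\tfrac1{2c},\tfrac1c]\cup[\tfrac2c,\tfrac4c]\cup[\tfrac9{2c},\infty)\}$. $\mathcal R_n(x,y)=\{\Gamma(x+\tfrac jn+iy):0\le j\le n-1\}$. *)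

(* Defs.v *)
From HB Require Import structures.
From mathcomp Require Import all_boot all_order all_algebra.
From mathcomp Require Import all_classical all_reals all_analysis.

Set Implicit Arguments.
Unset Strict Implicit.
Unset Printing Implicit Defensive.

Import Order.TTheory GRing.Theory Num.Theory.
Import numFieldNormedType.Exports.
Local Open Scope classical_set_scope.
Local Open Scope ring_scope.

Section Defs.
Variable R : realType.

(* A point z = x + i y of the plane is represented as the pair (x, y);
   the upper half plane H is { (x,y) | 0 < y }. *)
Definition upper_half : set (R * R) := [set p | 0 < p.2].

Definition isSL2Z (a b c d : int) : Prop := a * d - b * c = 1.

(* Moebius action of [[a b];[c d]] on z = x + i y:
   (a z + b)/(c z + d), written in real and imaginary parts. *)
Definition mob_den (c d : int) (p : R * R) : R :=
  (c%:~R * p.1 + d%:~R) ^+ 2 + (c%:~R * p.2) ^+ 2.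
Definition mob_re (a b c d : int) (p : R * R) : R :=
  ((a%:~R * p.1 + b%:~R) * (c%:~R * p.1 + d%:~R)
     + a%:~R * c%:~R * p.2 ^+ 2) / mob_den c d p.
Definition mob_im (a b c d : int) (p : R * R) : R :=
  p.2 / mob_den c d p.
Definition mob_act (a b c d : int) (p : R * R) : R * R :=
  (mob_re a b c d p, mob_im a b c d p).

Definition Ec_lift (c : R) : set (R * R) :=
  [set p | 0 < p.2 /\
     ((1 / (2 * c) <= p.2 <= 1 / c) \/ (2 / c <= p.2 <= 4 / c)
       \/ 9 / (2 * c) <= p.2)].

(* Subsets of M = Gamma\H are represented by their full (Gamma-invariant)
   preimages in H.  The preimage of the image of a set S in H: *)
Definition Gamma_saturation (S : set (R * R)) : set (R * R) :=
  [set p | 0 < p.2 /\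
     exists a b c d : int, isSL2Z a b c d /\ S (mob_act a b c d p)].

Definition Ec (c : R) : set (R * R) := Gamma_saturation (Ec_lift c).

Definition fund_dom : set (R * R) :=
  [set p | 0 < p.2 /\ `|p.1| <= 1 / 2 /\ 1 <= p.1 ^+ 2 + p.2 ^+ 2].

(* Normalized hyperbolic area mu_M = (3/pi) dx dy / y^2 of a subset of M,
   given by its Gamma-invariant preimage E in H, computed on the
   fundamental domain. *)
Definition muM (E : set (R * R)) : \bar R :=
  ((3 / pi)%:E *
   \int[(@lebesgue_measure R \x @lebesgue_measure R)%E]_(p in fund_dom `&` E)
      (p.2 ^- 2)%:E)%E.

Definition Rn_sub (E : set (R * R)) (n : nat) (x y : R) : Prop :=
  forall j : nat, (j < n)%N -> E (x + j%:R / n%:R, y).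

End Defs.

(* Main.v *)
Require Import Defs.
From HB Require Import structures.
From mathcomp Require Import all_boot all_order all_algebra.
From mathcomp Require Import all_classical all_reals all_analysis.
From mathcomp Require Import measurable_realfun zify ring lra.
Import Order.TTheory GRing.Theory Num.Theory.
Import numFieldNormedType.Exports.
Local Open Scope classical_set_scope.
Local Open Scope ring_scope.

(** If [n |n x - q| <= c], write [x = q/n + theta/n^2] with [|theta| <= c].
    Every point of R_n(x, c/n^2) is then [k/n + (theta + i c)/n^2] with [k] an
    integer; sending [k/n] to infinity by an element of SL_2(Z) gives it height
    [g^2 c/(theta^2 + c^2)], where [g = gcd(k, n)].  Since
    [1/(2c) <= c/(theta^2 + c^2) <= 1/c], the cases [g = 1], [g = 2], [g >= 3]
    give the three height ranges defining E_c, and Hurwitz's theorem provides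
    infinitely many such [n].

    Closedness holds because, near a point of H, only finitely many bottom rows
    [(u, v)] can bring the height above [1/(2c)].  The area is less than 1
    because the part [max(4/c, 2c) < y < 9/(2c)] of the fundamental domain
    avoids E_c: the heights of its other images are at most [1/y < 1/(2c)]. *)

(** * Hurwitz's approximation theorem by way of Farey neighbours *)

Section Hurwitz.
Set Implicit Arguments.
Unset Strict Implicit.
Variable R : realType.
Implicit Types (x : R) (a b c d : int).

Lemma irrational_mulz_neq x (p q : int) :
  irrational x -> q != 0 -> q%:~R * x != p%:~R.
Proof.
move=> xirr q0; apply/eqP => qx; apply: xirr.
exists (p%:~R / q%:~R) => //.
rewrite fmorph_div /= !ratr_int -qx mulrC mulKf// intr_eq0 //.
Qed.

Lemma irrationalN x : irrational x -> irrational (- x).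
Proof.
move=> xirr [q _ qx]; apply: xirr; exists (- q) => //.
by rewrite rmorphN /= qx opprK.
Qed.

(** Neighbouring fractions [a/b < x < c/d] of determinant 1, with denominators cleared so that only
    the linear errors [b x - a] and [c - d x] occur. *)
Definition farey_pair x a b c d :=
  [/\ b * c - a * d = 1, 0 < b, 0 < d, a%:~R < b%:~R * x & d%:~R * x < c%:~R].

Lemma farey_pairN x a b c d :
  farey_pair x a b c d -> farey_pair (- x) (- c) d (- a) b.
Proof. by case=> e b0 d0 ax xc; split=> //; first lia; rewrite mulrN rmorphN /= ltrN2. Qed.

(** A continued-fraction step: adding [k] times [(a, b)] to [(c, d)] keeps the determinant and
    replaces the right error [C] by its remainder modulo [A], nonzero because [x] is irrational. *)
Lemma farey_move_right x a b c d : irrational x -> farey_pair x a b c d ->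
  b%:~R * x - a%:~R < c%:~R - d%:~R * x ->
  exists c' d', [/\ farey_pair x a b c' d', d < d' &
    c'%:~R - d'%:~R * x < b%:~R * x - a%:~R].
Proof.
move=> xirr [e b0 d0 ax xc] AC.
set A := b%:~R * x - a%:~R in AC *; set C := c%:~R - d%:~R * x in AC.
have A0 : 0 < A by rewrite subr_gt0.
pose k := Num.floor (C / A).
have k1 : 1 <= k by rewrite floor_ge_int ler_pdivlMr ?mul1r ?ltW.
have kl : k%:~R * A <= C by rewrite -ler_pdivlMr// floor_le.
have kr : C < (k%:~R + 1) * A.
  by rewrite -ltr_pdivrMr// -[1]/(1%:~R) -intrD floorD1_gt.
have kb0 : 0 < k * b by rewrite mulr_gt0 //; lia.
have Cneq : (d + k * b)%:~R * x != (c + k * a)%:~R.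
  by apply: irrational_mulz_neq => //; lia.
have CE : (c + k * a)%:~R - (d + k * b)%:~R * x = C - k%:~R * A.
  by rewrite /A /C !rmorphD !rmorphM /=; ring.
exists (c + k * a), (d + k * b); rewrite /farey_pair CE; split; last lra; last lia.
split=> //; [nia | lia | ].
rewrite lt_neqAle Cneq -subr_ge0 CE; lra.
Qed.

(** Reflecting [x] to [-x] exchanges the two neighbours and reduces this to [farey_move_right]. *)
Lemma farey_move_left x a b c d : irrational x -> farey_pair x a b c d ->
  c%:~R - d%:~R * x < b%:~R * x - a%:~R ->
  exists a' b', [/\ farey_pair x a' b' c d, b < b' &
    b'%:~R * x - a'%:~R < c%:~R - d%:~R * x].
Proof.
move=> xirr /farey_pairN f AC.
have [|a' [b' [/farey_pairN]]] := farey_move_right (irrationalN xirr) f.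
  by rewrite !rmorphN /=; lra.
rewrite !opprK !rmorphN /= => f' bb' lt; exists (- a'), b'; split=> //.
by rewrite rmorphN /=; lra.
Qed.

Lemma farey_pair_neq x a b c d : irrational x -> farey_pair x a b c d ->
  b%:~R * x - a%:~R != c%:~R - d%:~R * x.
Proof.
move=> xirr [_ b0 d0 _ _].
have : (b + d)%:~R * x != (a + c)%:~R by apply: irrational_mulz_neq => //; lia.
by apply: contraNneq => h; apply/eqP; rewrite !rmorphD /=; lra.
Qed.

(** The neighbour with the larger error moves first; then the other one has the larger error and
    moves too. So both denominators grow in each round. *)
Lemma farey_pair_large x (N : nat) : irrational x ->
  exists a b c d, [/\ farey_pair x a b c d, N%:Z < b & N%:Z < d].
Proof.
move=> xirr; elim: N => [|N [a [b [c [d [f Nb Nd]]]]]].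
  exists (Num.floor x), 1, (Num.floor x + 1), 1; split=> //.
  split=> //; [lia| |by rewrite mul1r floorD1_gt].
  by rewrite lt_neqAle eq_sym irrational_mulz_neq//= mul1r floor_le.
have [lt|gt] := ltP (b%:~R * x - a%:~R) (c%:~R - d%:~R * x).
  have [c' [d' [f' dd' lt']]] := farey_move_right xirr f lt.
  have [a' [b' [f'' bb' _]]] := farey_move_left xirr f' lt'.
  by exists a', b', c', d'; split=> //; lia.
have {}gt : c%:~R - d%:~R * x < b%:~R * x - a%:~R.
  by rewrite lt_neqAle gt eq_sym farey_pair_neq.
have [a' [b' [f' bb' lt']]] := farey_move_left xirr f gt.
have [c' [d' [f'' dd' _]]] := farey_move_right xirr f' lt'.
by exists a', b', c', d'; split=> //; lia.
Qed.

(* If all three candidates failed, dividing [dA + bC = 1] and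
   [fA + b(C - A) = 1] (where [f = b + d]) by the products of denominators
   would give [((sqrt 5 - 1) b - 2 d)^2 < 0]. *)
Lemma hurwitz_mediant (s b d A C : R) : 0 < s -> 5 * s ^+ 2 = 1 ->
  0 < b -> 0 < d -> 0 < A -> A < C -> d * A + b * C = 1 ->
  [\/ b * A <= s, d * C <= s | (b + d) * (C - A) <= s].
Proof.
move=> s0 s5 b0 d0 A0 AC e.
have [|bA] := leP (b * A) s; first by constructor 1.
have [|dC] := leP (d * C) s; first by constructor 2.
have [|fC] := leP ((b + d) * (C - A)) s; first by constructor 3.
exfalso.
have h1 : s * (b ^+ 2 + d ^+ 2) < b * d.
  have -> : b * d = d ^+ 2 * (b * A) + b ^+ 2 * (d * C).
    by rewrite -[LHS]mulr1 -e; ring.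
  have := exprn_gt0 2 b0; have := exprn_gt0 2 d0; nra.
have h2 : s * (b ^+ 2 + (b + d) ^+ 2) < b * (b + d).
  have -> : b * (b + d) = (b + d) ^+ 2 * (b * A) + b ^+ 2 * ((b + d) * (C - A)).
    by rewrite -[LHS]mulr1 -e; ring.
  have := exprn_gt0 2 b0; have := exprn_gt0 2 (addr_gt0 b0 d0); nra.
have : 0 <= ((1 - s) * b - 2 * s * d) ^+ 2 by exact: sqr_ge0.
nra.
Qed.

(** Among two neighbours with denominators beyond [N] and their mediant, at least one approximates
    well enough. *)
Lemma hurwitz x (N : nat) : irrational x ->
  exists (n : nat) (p : int), (N < n)%N /\
    n%:R * `|n%:R * x - p%:~R| <= 1 / Num.sqrt 5.
Proof.
move=> xirr; set s := 1 / _.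
have s0 : 0 < s by rewrite divr_gt0// sqrtr_gt0.
have s5 : 5 * s ^+ 2 = 1.
  by rewrite /s div1r exprVn sqr_sqrtr// divff.
suff [m [p [Nm mp]]] : exists m p : int, N%:Z < m /\
    m%:~R * `|m%:~R * x - p%:~R| <= s.
  case: m Nm mp => [m|m] // Nm mp.
  by exists m, p; split; [lia | rewrite -pmulrn in mp].
have [a [b [c [d [f Nb Nd]]]]] := farey_pair_large N xirr.
have AC := farey_pair_neq xirr f.
case: f => e b0 d0 ax xc.
have A0 : 0 < b%:~R * x - a%:~R by rewrite subr_gt0.
have C0 : 0 < c%:~R - d%:~R * x by rewrite subr_gt0.
have eR : d%:~R * (b%:~R * x - a%:~R) + b%:~R * (c%:~R - d%:~R * x) = 1.
  have : (b * c - a * d)%:~R = 1 :> R by rewrite e.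
  by rewrite intrB !intrM => eR; rewrite -[RHS]eR; ring.
have [lt|le] := ltP (b%:~R * x - a%:~R) (c%:~R - d%:~R * x).
  have [] := hurwitz_mediant s0 s5 _ _ A0 lt eR; rewrite ?ltr0z// => h.
  - by exists b, a; split=> //; rewrite gtr0_norm.
  - by exists d, c; split=> //; rewrite distrC gtr0_norm.
  - exists (b + d), (a + c); split; first lia.
    by rewrite distrC gtr0_norm !rmorphD /=; lra.
have {le AC} lt : c%:~R - d%:~R * x < b%:~R * x - a%:~R.
  by rewrite lt_neqAle le eq_sym AC.
(* Left and right exchange roles, so that the smaller error again comes first. *)
rewrite addrC in eR.
have [] := hurwitz_mediant s0 s5 _ _ C0 lt eR; rewrite ?ltr0z// => h.
- by exists d, c; split=> //; rewrite distrC gtr0_norm.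
- by exists b, a; split=> //; rewrite gtr0_norm.
- exists (b + d), (a + c); split; first lia.
  by rewrite gtr0_norm !rmorphD /=; lra.
Qed.
End Hurwitz.

(** * Heights along bottom rows, membership in [Ec], and closedness *)

Section GammaSaturation.
Set Implicit Arguments.
Unset Strict Implicit.
Variable R : realType.
Implicit Types (c : R) (p : R * R) (u v : int).

Definition heights c : set R := [set t |
  1 / (2 * c) <= t <= 1 / c \/ 2 / c <= t <= 4 / c \/ 9 / (2 * c) <= t].

Lemma mob_den_gt0 u v p : coprimez u v -> 0 < p.2 -> 0 < mob_den u v p.
Proof.
move=> uv p0; rewrite /mob_den.
have [u0|u0] := eqVneq u 0.
  rewrite u0 mul0r add0r ltr_pwDl ?sqr_ge0// exprn_even_gt0//= intr_eq0.
  by apply: contraTneq uv => ->; rewrite u0.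
rewrite ltr_wpDl ?sqr_ge0// exprn_even_gt0//= mulf_neq0 ?intr_eq0//.
by rewrite gt_eqF.
Qed.

(** The height of an image depends only on the bottom row of the matrix, and by Bezout every coprime
    row is completed to an element of SL_2(Z). *)
Lemma EcP c p : 0 < p.2 -> (Ec c p <-> exists u v,
  coprimez u v /\ heights c (p.2 / mob_den u v p)).
Proof.
move=> p0; split.
  move=> [_ [a [b [u [v [e [_ h]]]]]]]; exists u, v; split=> //.
  apply/coprimezP; exists (- b, a) => /=; rewrite /isSL2Z in e; lia.
move=> [u [v [uv h]]]; split=> //.
have /coprimezP [[b a] /= e] := uv.
exists a, (- b), u, v; split; first by rewrite /isSL2Z; lia.
by split=> //=; rewrite divr_gt0// mob_den_gt0.
Qed.

Lemma Ec_rational_shift c (x : R) (n : nat) (q : int) (j : nat) :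
  0 < c -> (0 < n)%N -> n%:R * `|n%:R * x - q%:~R| <= c ->
  Ec c (x + j%:R / n%:R, c / n%:R ^+ 2).
Proof.
move=> c0 n0 h; have nR : 0 < n%:R :> R by rewrite ltr0n.
apply/EcP => /=; first by rewrite divr_gt0// exprn_gt0.
(* This is theta: [x + j/n = k/n + t/n^2] with [k = q + j]. *)
pose t := n%:R * (n%:R * x - q%:~R).
have tc : `|t| <= c by rewrite normrM gtr0_norm.
have {tc h} t2 : t ^+ 2 <= c ^+ 2 by rewrite -[t ^+ 2]real_normK ?num_real// ler_sqr ?nnegrE// ltW.
pose k := q + j; pose g := gcdz n k.
have g0 : 0 < g by rewrite /g /gcdz ltz_nat gcdn_gt0 /= n0.
have /dvdzP [u nE] : (g %| n%:Z)%Z by exact: dvdz_gcdl.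
have /dvdzP [v kE] : (g %| k)%Z by exact: dvdz_gcdr.
(* The row [(n/g, -k/g)] sends [k/n] to infinity; its coprimality follows by cancelling [g]. *)
exists u, (- v); split.
  rewrite coprimezN /coprimez -(inj_eq (mulIf (lt0r_neq0 g0))) mul1r.
  by rewrite -{1}(gtz0_abs g0) mulz_gcdl -nE -kE.
have gR : 1 <= g%:~R :> R by rewrite ler1z; lia.
have nER : n%:R = u%:~R * g%:~R :> R by rewrite -intrM -nE pmulrn.
have kER : q%:~R + j%:R = v%:~R * g%:~R :> R.
  by rewrite -intrM -kE intrD pmulrn.
have u0 : u%:~R != 0 :> R by apply: contraTneq nR; rewrite nER => ->; rewrite mul0r ltxx.
have s0 : 0 < t ^+ 2 + c ^+ 2 by rewrite ltr_wpDl ?sqr_ge0// exprn_gt0.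
(* Since [u k/n = v], the value [u z - v] is [(t + i c)/(g n)]. *)
have -> : c / n%:R ^+ 2 / mob_den u (- v) (x + j%:R / n%:R, c / n%:R ^+ 2) =
    g%:~R ^+ 2 * (c / (t ^+ 2 + c ^+ 2)).
  have -> : mob_den u (- v) (x + j%:R / n%:R, c / n%:R ^+ 2) =
      (t ^+ 2 + c ^+ 2) / (g%:~R * n%:R) ^+ 2.
    have jE : j%:R = v%:~R * g%:~R - q%:~R :> R by rewrite -kER; ring.
    rewrite /mob_den /= /t rmorphN /= jE nER; field.
    by rewrite u0 gt_eqF ?(lt_le_trans ltr01).
  by field; rewrite !gt_eqF// (lt_le_trans ltr01).
set w := c / _.
have w1 : w <= 1 / c.
  by rewrite /w ler_pdivrMr// mulrAC ler_pdivlMr//; have := sqr_ge0 t; lra.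
have w2 : 1 / (2 * c) <= w.
  by rewrite /w ler_pdivlMr// mulrAC ler_pdivrMr ?mulr_gt0//; lra.
have gN : 0 <= w by rewrite divr_ge0// ltW.
have c1 : 0 <= 1 / c by rewrite divr_ge0// ltW.
rewrite /heights /=.
(* All bounds become multiples of [1/c], so that the cases below can be settled by linear
   arithmetic. *)
have E1 : 1 / (2 * c) = 1 / c / 2 by field; rewrite gt_eqF.
have E2 : 2 / c = 2 * (1 / c) by field; rewrite gt_eqF.
have E4 : 4 / c = 4 * (1 / c) by field; rewrite gt_eqF.
have E9 : 9 / (2 * c) = 9 * (1 / c / 2) by field; rewrite gt_eqF.
rewrite {}E1 {}E2 {}E4 {}E9 in w2 *.
(* Multiplying [[1/(2c), 1/c]] by [g^2], which is 1, 4 or at least 9, lands in the three ranges in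
   turn. *)
have [g1|g1] := eqVneq g 1; first by left; rewrite g1; apply/andP; split; lra.
have [g2|g2] := eqVneq g 2.
  by right; left; rewrite g2 -[2%:~R]/(2 : R); apply/andP; split; lra.
right; right.
have g3z : 3 <= g by clear -g0 g1 g2; lia.
have g3 : 3 <= g%:~R :> R by rewrite (ler_int R 3).
have : 9 <= g%:~R ^+ 2 :> R by nra.
nra.
Qed.

Lemma closed_heights c : closed (heights c).
Proof.
have cI a b : closed [set t : R | a <= t <= b].
  have -> : [set t : R | a <= t <= b] = [set t | a <= t] `&` [set t | t <= b].
    by apply/seteqP; split=> t /=; [move/andP|move=> [-> ->]].
  exact: closedI (@closed_ge _ _) (@closed_le _ _).
exact: closedU (cI _ _) (closedU (cI _ _) (@closed_ge _ _)).
Qed.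

(** For a fixed row the height is continuous at [p], and [heights c] is closed. *)
Lemma nbhs_nheights c u v p : 0 < p.2 -> coprimez u v ->
  ~ heights c (p.2 / mob_den u v p) ->
  \forall q \near p, ~ heights c (q.2 / mob_den u v q).
Proof.
move=> p0 uv nh.
have cf : {for p, continuous (fun q : R * R => q.2 / mob_den u v q)}.
  have c1 : {for p, continuous (@fst R R)} by exact: cvg_fst.
  have c2 : {for p, continuous (@snd R R)} by exact: cvg_snd.
  apply: continuousM => //; apply: continuousV; first by rewrite gt_eqF// mob_den_gt0.
  rewrite /mob_den; apply: continuousD; apply: continuousM; rewrite ?expr1//.
  - apply: continuousD; last exact: cst_continuous.
    by apply: continuousM; first exact: cst_continuous.
  - apply: continuousD; last exact: cst_continuous.
    by apply: continuousM; first exact: cst_continuous.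
  - by apply: continuousM; first exact: cst_continuous.
  - by apply: continuousM; first exact: cst_continuous.
apply: (cf (~` heights c)); apply: open_nbhs_nbhs; split=> //.
by apply: closed_openC; exact: closed_heights.
Qed.

(** Every element of [heights c] is at least [1/(2c)]. This bounds [mob_den], hence both entries of
    the row, uniformly near [p]. *)
Lemma near_bounded_coefs c p : 0 < c -> 0 < p.2 -> exists M : nat,
  \forall q \near p, 0 < q.2 /\ forall u v,
    heights c (q.2 / mob_den u v q) -> coprimez u v -> `|u| <= M%:Z /\ `|v| <= M%:Z.
Proof.
(* For [q.2] between [p.2/2] and [2 p.2], [D] bounds the denominator, [U] bounds [u^2], and [V]
   bounds [|v|] through [v = (u q.1 + v) - u q.1]. *)
move=> c0 p0; pose D := 4 * c * p.2; pose U := 4 * D / p.2 ^+ 2.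
pose V := U * (`|p.1| + 1) + (1 + D).
have D0 : 0 < D by rewrite /D !mulr_gt0.
have U0 : 0 < U by rewrite /U divr_gt0 ?exprn_gt0// mulr_gt0.
have V0 : 0 <= V.
  exact: addr_ge0 (mulr_ge0 (ltW U0) (addr_ge0 (normr_ge0 _) ler01))
                  (addr_ge0 ler01 (ltW D0)).
have UV : 0 <= U + V by exact: addr_ge0 (ltW U0) V0.
exists (Num.bound (U + V)).
have c1 : {for p, continuous (@fst R R)} by exact: cvg_fst.
have c2 : {for p, continuous (@snd R R)} by exact: cvg_snd.
have n1 : \forall q \near p, `|p.1 - q.1| < 1.
  by move/cvgrPdist_lt : c1; apply.
have n2 : \forall q \near p, `|p.2 - q.2| < p.2 / 2.
  by move/cvgrPdist_lt : c2; apply; rewrite divr_gt0.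
apply: filterS2 n1 n2 => q q1 qd2.
have [q2l q2r] : p.2 / 2 < q.2 /\ q.2 < 2 * p.2.
  by move: qd2; rewrite ltr_norml => /andP[]; split; lra.
have q20 : 0 < q.2 by lra.
split=> // u v h uv.
have den : mob_den u v q <= D.
  have d0 := mob_den_gt0 uv q20.
  have : 1 / (2 * c) <= q.2 / mob_den u v q.
    have i0 : 0 < c^-1 by rewrite invr_gt0.
    have E : 1 / (2 * c) = c^-1 / 2 by field; rewrite gt_eqF.
    have E9 : 9 / (2 * c) = 9 * (c^-1 / 2) by field; rewrite gt_eqF.
    move: h; rewrite /heights /= E E9 => -[/andP[]//|[/andP[h _]|h]]; lra.
  rewrite ler_pdivlMr// mulrAC ler_pdivrMr ?mulr_gt0// /D; nra.
have uD : (u%:~R * q.2) ^+ 2 <= D.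
  by apply: le_trans den; rewrite /mob_den lerDr sqr_ge0.
have vD : (u%:~R * q.1 + v%:~R) ^+ 2 <= D.
  by apply: le_trans den; rewrite /mob_den lerDl sqr_ge0.
have sqU : u%:~R ^+ 2 <= U.
  rewrite /U ler_pdivlMr ?exprn_gt0//.
  have q2 : p.2 ^+ 2 <= 4 * q.2 ^+ 2 by rewrite -subr_ge0; nra.
  apply: (le_trans (ler_wpM2l (sqr_ge0 _) q2)).
  by rewrite mulrCA -exprMn ler_pM2l.
have uU : `|u%:~R| <= U :> R.
  apply: le_trans sqU; rewrite -intr_norm -rmorphXn ler_int.
  have [->|u0] := eqVneq u 0; first by rewrite normr0.
  by rewrite -[u ^+ 2]real_normK ?num_real// expr2 ler_peMr// -gtz0_ge1 normr_gt0.
have vV : `|v%:~R| <= V :> R.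
  have -> : v%:~R = (u%:~R * q.1 + v%:~R) - u%:~R * q.1 :> R by ring.
  apply: (le_trans (ler_normB _ _)); rewrite addrC /V lerD//.
    rewrite normrM ler_pM//.
    rewrite -[q.1](subrKC p.1) (le_trans (ler_normD _ _))// lerD2l distrC.
    exact: ltW.
  move: vD; rewrite -real_normK ?num_real//; set w := `|_| => vD.
  (* From [w^2 <= D] this square yields [w <= D + 1/4] without a square root. *)
  by have := sqr_ge0 (2 * w - 1); lra.
have bP := archi_boundP UV.
rewrite -!(ler_int R) !intr_norm -pmulrn; split.
  by rewrite (le_trans uU)// ltW// (le_lt_trans _ bP)//; have := normr_ge0 (v%:~R : R); lra.
by rewrite (le_trans vV)// ltW// (le_lt_trans _ bP)//; lra.
Qed.

Lemma Ec_closed_in_H c p : 0 < c -> 0 < p.2 -> closure (Ec c) p -> Ec c p.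
Proof.
move=> c0 p0 clp; apply: contrapT => nE.
have [M nM] := near_bounded_coefs c0 p0.
(* The integers from [-M] to [M] are indexed by a finite type, so the neighbourhoods for all rows
   can be intersected. *)
pose z (i : 'I_(2 * M).+1) : int := i%:Z - M%:Z.
pose P i j q := coprimez (z i) (z j) -> ~ heights c (q.2 / mob_den (z i) (z j) q).
have nz : \forall q \near p, forall i j, P i j q.
  refine (@filter_forall _ _ (fun i q => forall j, P i j q) (nbhs p) _ _); last move=> i.
  refine (@filter_forall _ _ (P i) (nbhs p) _ _); last move=> j.
  have [cop|ncop] := boolP (coprimez (z i) (z j)); last first.
    by apply: filterS filterT => q _; rewrite /P (negbTE ncop).
  have nh : ~ heights c (p.2 / mob_den (z i) (z j) p).
    by move=> h; apply: nE; apply/EcP => //; exists (z i), (z j).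
  by apply: filterS (nbhs_nheights p0 cop nh) => q nq _.
have [q [Eq [[q0 qM] qz]]] := clp _ (filterI nM nz).
have /(EcP c q0) [u [v [uv h]]] := Eq.
have [uM vM] := qM _ _ h uv.
have zP (w : int) : `|w| <= M%:Z -> exists i, z i = w.
  move=> wM; have lt : (`|(w + M%:Z)%R| < (2 * M).+1)%N by lia.
  by exists (Ordinal lt); rewrite /z /=; lia.
have [[i iu] [j jv]] := (zP _ uM, zP _ vM).
by move: (qz i j); rewrite /P iu jv => /(_ uv).
Qed.
End GammaSaturation.

(** * The height gap, the area of the fundamental domain, and the bound on [muM] *)

Section Area.
Set Implicit Arguments.
Unset Strict Implicit.
Variable R : realType.
Implicit Types (c x y : R) (p : R * R).

(** A row with [u = 0] has [v = 1] or [v = -1] and keeps the height, which lies in the gap. A row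
    with [u != 0] has denominator at least [p.2^2], so the height drops to at most
    [1/p.2 < 1/(2c)]. *)
Lemma Ec_gap c p : 0 < c -> 1 <= p.2 -> 4 / c < p.2 -> 2 * c < p.2 ->
  p.2 < 9 / (2 * c) -> ~ Ec c p.
Proof.
move=> c0 p1 p4 p2 p9; have p0 : 0 < p.2 by lra.
move/(EcP c p0) => [u [v [uv h]]].
have i0 : 0 < c^-1 by rewrite invr_gt0.
have E1 : 1 / (2 * c) = c^-1 / 2 by field; rewrite gt_eqF.
have E9 : 9 / (2 * c) = 9 * (c^-1 / 2) by field; rewrite gt_eqF.
rewrite E9 in p9; rewrite /heights /= E1 E9 in h.
have [u0|u0] := eqVneq u 0.
  have v2 : v%:~R ^+ 2 = 1 :> R.
    move: uv; rewrite u0 coprimezE /coprime gcd0n => /eqP v1.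
    by rewrite -rmorphXn /= -[v ^+ 2]real_normK ?num_real// -abszE v1.
  rewrite /mob_den u0 !mul0r add0r v2 expr0n addr0 divr1 in h.
  by case: h => [/andP[]|[/andP[]|]]; lra.
have : p.2 / mob_den u v p < c^-1 / 2.
  rewrite ltr_pdivrMr ?mob_den_gt0//.
  have den : p.2 ^+ 2 <= mob_den u v p.
    rewrite /mob_den ler_wpDl ?sqr_ge0// exprMn ler_peMl ?sqr_ge0//.
    by rewrite -rmorphXn ler1z -gtz0_ge1 exprn_even_gt0.
  rewrite (lt_le_trans _ (ler_wpM2l _ den))//; last by rewrite divr_ge0 ?ltW.
  have cV : c^-1 * c = 1 by rewrite mulVf ?gt_eqF.
  have : c^-1 * (2 * c) < c^-1 * p.2 by rewrite ltr_pM2l.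
  by nra.
by case: h => [/andP[]|[/andP[]|]]; lra.
Qed.

(** The triple-angle formula at [pi/6] reads [3s - 4s^3 = 1], that is [(s + 1)(2s - 1)^2 = 0], and
    [s > 0]. *)
Lemma sin_pi6 : sin (pi / 6) = 1 / 2 :> R.
Proof.
set t := pi / 6.
have pi0 : 0 < pi :> R by exact: pi_gt0.
have s0 : 0 < sin t by apply: sin_gt0_pi; rewrite /t; apply/andP; split; lra.
have : sin (t + (t + t)) = 1.
  by rewrite (_ : t + (t + t) = pi / 2) ?sin_pihalf// /t; field.
have := cos2Dsin2 t; rewrite !sinD !cosD.
set s := sin t in s0 *; set k := cos t => e.
have -> : s * (k * k - s * s) + k * (s * k + k * s) = s * (3 * (k ^+ 2 + s ^+ 2) - 4 * s ^+ 2).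
  by ring.
rewrite e => /eqP; rewrite -subr_eq0.
have -> : s * (3 * 1 - 4 * s ^+ 2) - 1 = - ((s + 1) * (2 * s - 1) ^+ 2) by ring.
rewrite oppr_eq0 mulf_eq0 expf_eq0 /= gt_eqF ?addr_gt0//= => /eqP; lra.
Qed.

Lemma asin_half : asin (1 / 2) = pi / 6 :> R.
Proof.
rewrite -sin_pi6 sinK// in_itv /=; have := pi_gt0 R; move=> h; apply/andP; split; lra.
Qed.

Lemma asinN_half : asin (- (1 / 2)) = - (pi / 6) :> R.
Proof.
rewrite -sin_pi6 -sinN sinK// in_itv /=; have := pi_gt0 R; move=> h; apply/andP; split; lra.
Qed.

Local Notation mu := (@lebesgue_measure R).

(** Inner integral of the area: the antiderivative [-1/y] tends to 0 at infinity. *)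
Lemma integral_inv_sqr_itvy (a : R) : 0 < a ->
  (\int[mu]_(y in `[a, +oo[) (y ^- 2)%:E = (a^-1)%:E)%E.
Proof.
move=> a0.
have D y : y != 0 -> is_derive y 1 (fun z : R => - z^-1) (y ^- 2).
  move=> y0; have dV := is_deriveV (f := id) y0 (is_derive_id y 1).
  by apply: (is_derive_eq (is_deriveN dV)); rewrite scaleNr opprK /GRing.scale /= mulr1.
have C y : y != 0 -> {for y, continuous (fun z : R => z ^- 2)}.
  move=> y0; apply: (@continuousV _ _ (fun z : R => z ^+ 2)); first by rewrite expf_neq0.
  exact: exprn_continuous.
rewrite (@ge0_continuous_FTC2y R _ (fun z : R => - z^-1) a 0).
- by rewrite EFinN oppeK add0e.
- by move=> y ay; rewrite invr_ge0 sqr_ge0.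
- apply/continuous_within_itvcyP; split.
    by move=> y; rewrite in_itv/= andbT => ay; apply: C; rewrite gt_eqF ?(lt_trans a0).
  by apply: cvg_at_right_filter; apply: C; rewrite gt_eqF.
- rewrite -oppr0; apply: cvgN; apply/(gtr0_cvgV0 (f := id)); last exact: cvg_id.
  exact: nbhs_pinfty_gt.
- by move=> y ay; have [] := D y (lt0r_neq0 (lt_trans a0 ay)).
- apply: cvg_at_right_filter; apply: cvgN; apply: continuousV; rewrite ?gt_eqF//.
- move=> y; rewrite in_itv/= andbT => ay; rewrite derive1E.
  by have [_ ->] := D y (lt0r_neq0 (lt_trans a0 ay)).
Qed.

(** Outer integral of the area, with antiderivative [asin]. *)
Lemma integral_inv_sqrt_1Bsqr :
  (\int[mu]_(x in `[(- (1 / 2))%R, (1 / 2)%R]) ((Num.sqrt (1 - x ^+ 2))^-1)%:E = (pi / 3)%:E)%E.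
Proof.
have C x : -1 < x < 1 -> {for x, continuous (fun z : R => (Num.sqrt (1 - z ^+ 2))^-1)}.
  move=> /andP[x1 x2]; apply: (@continuousV _ _ (fun z : R => Num.sqrt (1 - z ^+ 2))).
    by rewrite gt_eqF// sqrtr_gt0; nra.
  apply: (@continuous_comp _ _ _ (fun z : R => 1 - z ^+ 2) Num.sqrt).
    apply: continuousB; first exact: cst_continuous.
    exact: exprn_continuous.
  exact: sqrt_continuous.
rewrite (@continuous_FTC2 _ _ asin)//.
- by rewrite asin_half asinN_half -EFinB; congr EFin; field.
- by lra.
- apply: continuous_in_subspaceT => x; rewrite inE/= in_itv/= => /andP[x1 x2].
  by apply: C; apply/andP; split; lra.
- split.
  + move=> x; rewrite in_itv/= => /andP[x1 x2].
    have x11 : -1 < x < 1 by apply/andP; split; lra.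
    by have [] := is_derive1_asin x11.
  + by apply: cvg_at_right_filter; apply: continuous_asin; apply/andP; split; lra.
  + by apply: cvg_at_left_filter; apply: continuous_asin; apply/andP; split; lra.
- move=> x; rewrite in_itv/= => /andP[x1 x2].
  have x11 : -1 < x < 1 by apply/andP; split; lra.
  by rewrite derive1E; have [_ ->] := is_derive1_asin x11.
Qed.

Lemma fund_dom_xsection x y : `|x| <= 1 / 2 ->
  fund_dom (x, y) <-> Num.sqrt (1 - x ^+ 2) <= y.
Proof.
move=> x2; have x4 : x ^+ 2 <= 1 / 4.
  by rewrite -[x ^+ 2]real_normK ?num_real//; have := normr_ge0 x; nra.
have s0 : 0 < Num.sqrt (1 - x ^+ 2) by rewrite sqrtr_gt0; lra.
have sE : Num.sqrt (1 - x ^+ 2) ^+ 2 = 1 - x ^+ 2 by rewrite sqr_sqrtr; lra.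
split=> [[/= y0 [_ xy]]|sy].
  by rewrite leNgt; apply/negP => ys; move: xy => /=; nra.
have y0 : 0 < y by apply: lt_le_trans sy.
split=> //; split=> //=.
by nra.
Qed.

Lemma measurable_fund_dom : measurable (@fund_dom R).
Proof.
have mf : measurable_fun setT (fun p : R * R => `|p.1|) by exact: measurableT_comp.
have mg : measurable_fun setT (fun p : R * R => p.1 ^+ 2 + p.2 ^+ 2).
  by apply: measurable_funD; apply: measurable_funX.
have -> : @fund_dom R = snd @^-1` `]0, +oo[ `&`
    ((fun p => `|p.1|) @^-1` `]-oo, (1 / 2)] `&`
     (fun p => p.1 ^+ 2 + p.2 ^+ 2) @^-1` `[1, +oo[).
  by apply/seteqP; split=> p /=; rewrite !in_itv/= !andbT.
apply: measurableI; last apply: measurableI.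
- by rewrite -[X in measurable X]setTI; apply: measurable_snd.
- by rewrite -[X in measurable X]setTI; apply: mf.
- by rewrite -[X in measurable X]setTI; apply: mg.
Qed.

Lemma measurable_inv_sqr_snd :
  measurable_fun (@fund_dom R) (fun p : R * R => (p.2 ^- 2)%:E).
Proof.
apply/measurable_EFinP.
have mV : measurable_fun (`]0, +oo[ : set R) (fun y : R => y ^- 2).
  apply: open_continuous_measurable_fun => // y; rewrite inE/= in_itv/= andbT => y0.
  apply: (@continuousV _ _ (fun z : R => z ^+ 2)); first by rewrite expf_neq0// gt_eqF.
  exact: exprn_continuous.
have ms : measurable_fun (@fund_dom R) (@snd R R) by exact: measurable_funTS.
have sub : [set snd p | p in @fund_dom R] `<=` (`]0, +oo[ : set R).
  by move=> _ [p [p0 _] <-]; rewrite /= in_itv/= p0.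
exact: (measurable_comp _ sub mV ms).
Qed.

(** Tonelli with vertical slices: the slice over [x] starts at [sqrt (1 - x^2)] and contributes the
    inverse of that height. *)
Lemma area_fund_dom :
  (\int[mu \x mu]_(p in @fund_dom R) (p.2 ^- 2)%:E = (pi / 3)%:E)%E.
Proof.
rewrite integral_mkcond fubini_tonelli1; last 2 first.
- apply/(measurable_restrictT _ _).1; first exact: measurable_fund_dom.
  exact: measurable_inv_sqr_snd.
- by move=> p; apply: erestrict_ge0 => q _; rewrite lee_fin invr_ge0 sqr_ge0.
rewrite -integral_inv_sqrt_1Bsqr [RHS]integral_mkcond.
apply: eq_integral => x _; rewrite /fubini_F patchE.
have [x2|x2] := boolP (`|x| <= 1 / 2); last first.
  rewrite memNset/=; last by rewrite in_itv/= -ler_norml; exact/negP.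
  apply: integral0_eq => y _; rewrite patchE memNset// => -[_ [/= x2' _]].
  by rewrite x2' in x2.
rewrite mem_set/=; last by rewrite in_itv/= -ler_norml.
have s0 : 0 < Num.sqrt (1 - x ^+ 2).
  rewrite sqrtr_gt0 -[x ^+ 2]real_normK ?num_real//.
  by have := normr_ge0 x; nra.
rewrite -integral_inv_sqr_itvy// [RHS]integral_mkcond; apply: eq_integral => y _.
rewrite !patchE; congr (if _ then _ else _).
apply/idP/idP; rewrite !inE/= in_itv/= andbT; first by move/(fund_dom_xsection _ x2).
by move=> h; apply/fund_dom_xsection.
Qed.

(** The integral is a supremum over simple functions below the restricted integrand, and that family
    grows with the set. It serves for [fund_dom] intersected with an arbitrary [E]. *)
Lemma ge0_le_integral_subset d (T : measurableType d)
    (m : {measure set T -> \bar R}) (A B : set T) (f : T -> \bar R) :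
  (forall t, B t -> (0 <= f t)%E) -> A `<=` B ->
  (\int[m]_(t in A) f t <= \int[m]_(t in B) f t)%E.
Proof.
move=> f0 AB; rewrite !ge0_integralE//; last by move=> t /AB /f0.
apply: le_ereal_sup => _ [h hf <-]; exists h => // t.
apply: (le_trans (hf t)); rewrite !patchE.
have [/set_mem/AB Bt|_] := boolP (t \in A); first by rewrite mem_set.
by case: ifPn => // /set_mem /f0.
Qed.

(** The box [B] of width 1 over heights in [(a, b)] lies in the fundamental domain because [a >= 1],
    misses [E], and has positive area. *)
Lemma muM_lt1_of_gap (E : set (R * R)) (a b : R) : 1 <= a -> a < b ->
  (forall p, a < p.2 < b -> ~ E p) -> (muM E < 1)%E.
Proof.
move=> a1 ab gap.
pose B : set (R * R) := `[(- (1 / 2)), (1 / 2)]%classic `*` `]a, b[%classic.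
have mB : measurable B by exact: measurableX.
have BF : B `<=` @fund_dom R.
  move=> p [/=]; rewrite !in_itv/= -ler_norml => px /andP[ap pb].
  have p1 : 1 < p.2 by apply: le_lt_trans ap.
  split; first lra; split=> //; have := sqr_ge0 p.1; nra.
pose f (p : R * R) := (p.2 ^- 2)%:E.
have f0 p : (0 <= f p)%E by rewrite lee_fin invr_ge0 sqr_ge0.
have FB : @fund_dom R = (@fund_dom R `\` B) `|` B by rewrite setUC setDUK.
have intF : (\int[mu \x mu]_(p in @fund_dom R `\` B) f p +
             \int[mu \x mu]_(p in B) f p = (pi / 3)%:E)%E.
  rewrite -ge0_integral_setU//.
  - by rewrite -FB area_fund_dom.
  - by apply: measurableD => //; exact: measurable_fund_dom.
  - by rewrite -FB; exact: measurable_inv_sqr_snd.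
  - by rewrite disj_set2E setDE -setIA setICl setI0.
(* On [B] the density [y^-2] is at least [b^-2]. *)
have intB : ((b ^- 2 * (b - a))%:E <= \int[mu \x mu]_(p in B) f p)%E.
  have <- : (\int[mu \x mu]_(p in B) (cst (b ^- 2)%:E) p = (b ^- 2 * (b - a))%:E)%E.
    rewrite integral_cst// /B [X in (_ * X)%E]product_measure1E//=.
    rewrite !lebesgue_measure_itv/= !lte_fin ab.
    rewrite ifT; last lra.
    by rewrite -!EFinB -!EFinM; congr EFin; field; rewrite gt_eqF//; lra.
  apply: ge0_le_integral => //.
  - by move=> p _; rewrite lee_fin invr_ge0 sqr_ge0.
  - by apply: measurable_funS BF measurable_inv_sqr_snd; exact: measurable_fund_dom.
  - move=> p [_ /=]; rewrite in_itv/= => /andP[ap pb].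
    by rewrite lee_fin lef_pV2 ?posrE ?exprn_gt0 ?lerXn2r ?nnegrE//; lra.
have EF : (\int[mu \x mu]_(p in @fund_dom R `&` E) f p <=
           \int[mu \x mu]_(p in @fund_dom R `\` B) f p)%E.
  apply: ge0_le_integral_subset => // p [Fp Ep]; split=> // -[_ /=].
  by rewrite in_itv/= => /gap.
have b0 : 0 < b ^- 2 * (b - a).
  by rewrite mulr_gt0 ?subr_gt0// invr_gt0 exprn_gt0//; lra.
(* A finite total forces both summands to be finite, so a strict inequality survives in the extended
   reals. *)
have sum_lt (u v : \bar R) (r s : R) :
    (u + v = s%:E -> r%:E <= v -> 0 < r%:E -> u < s%:E)%E.
  case: u v => [u| |] [v| |] //= [<-]; rewrite !lee_fin !lte_fin; lra.
have lt := le_lt_trans EF (sum_lt _ _ _ _ intF intB b0).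
have pi0 : 0 < pi :> R by exact: pi_gt0.
have piK : ((3 / pi)%:E * (pi / 3)%:E = 1%:E :> \bar R)%E.
  by rewrite -EFinM mulrA divfK ?divff ?gt_eqF.
by rewrite /muM -piK lte_pmul2l// lte_fin divr_gt0.
Qed.
End Area.

Theorem theorem4p5 (R : realType) (c : R) :
  1 / Num.sqrt 5 <= c -> c < 3 / 2 ->
  (* E_c is closed in M: its preimage is closed in H *)
  (forall p : R * R, 0 < p.2 -> closure (Ec c) p -> Ec c p) /\
  (muM (Ec c) < 1)%E /\
  (forall x : R, 0 <= x -> x < 1 -> @irrational R x ->
     forall N : nat, exists n : nat, (N < n)%N /\
       Rn_sub (Ec c) n x (c / (n%:R ^+ 2))).
Proof.
move=> cl cr.
have c0 : 0 < c by apply: lt_le_trans cl; rewrite divr_gt0// sqrtr_gt0.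
split; first by move=> p; exact: Ec_closed_in_H.
split.
  have i0 : 0 < c^-1 by rewrite invr_gt0.
  have cV : c^-1 * c = 1 by rewrite mulVf ?gt_eqF.
  have E9 : 9 / (2 * c) = 9 * (c^-1 / 2) by field; rewrite gt_eqF.
  apply: (@muM_lt1_of_gap _ _ (Num.max (4 / c) (2 * c)) (9 / (2 * c))).
  - by rewrite le_max; apply/orP; left; nra.
  (* The gap is nonempty: [2c < 9/(2c)] amounts to [c < 3/2]. *)
  - by rewrite gt_max E9; apply/andP; split; nra.
  - move=> p; rewrite gt_max => /andP[/andP[p4 p2] p9].
    by apply: Ec_gap => //; nra.
(* The lower bound on [c] turns the Hurwitz constant [1/sqrt 5] into the required bound [c]. *)
move=> x _ _ xirr N; have [n [q [Nn h]]] := hurwitz N xirr.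
exists n; split=> // j _; apply: Ec_rational_shift (le_trans h cl) => //.
exact: leq_ltn_trans Nn.
Qed.
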